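(* Let $n = p_1p_2p_3$ where $p_1<p_2<p_3$ are odd primes. Then $$\max\left\{\,p_1-1,\ 2n\,\frac{1}{p_1}-\deg(\Psi_n)\right\}\ \le\ g(\Psi_n)\ <\ 2n\left(\frac{1}{p_1}+\frac{1}{p_2}+\frac{1}{p_3}\right)-\deg(\Psi_n).$$
   Context: $\Psi_n$ denotes the $n$-th inverse cyclotomic polynomial, $\Psi_n(x) = \prod_{1\le j\le n,\ \gcd(j,n)>1}(x-\zeta_n^j)$, where $\zeta_n$ is a primitive $n$-th root of unity. Maximum gap: for a nonzero univariate polynomial $f = c_1x^{e_1}+\cdots+c_tx^{e_t}$ with $c_1,\ldots,c_t\neq 0$ and $e_1<\cdots<e_t$, the maximum gap of $f$ is $g(f) = \max_{1\le i<t}(e_{i+1}-e_i)$, with $g(f)=0$ when $t=1$. *)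

(* Defs.v *)
From HB Require Import structures.
From mathcomp Require Import all_boot all_order all_algebra all_field.

Set Implicit Arguments.
Unset Strict Implicit.
Unset Printing Implicit Defensive.

Import Order.TTheory GRing.Theory Num.Theory.
Local Open Scope ring_scope.

(* The n-th inverse cyclotomic polynomial when z is a primitive n-th root of
   unity; the companion of [cyclotomic z n]. *)
Definition inv_cyclotomic (R : nzRingType) (z : R) (n : nat) : {poly R} :=
  \prod_(1 <= j < n.+1 | (1 < gcdn j n)%N) ('X - (z ^+ j)%:P).

(* [size p] is the degree plus one; the zero polynomial gets degree 0. *)
Definition deg (R : nzRingType) (p : {poly R}) : nat := (size p).-1.

(* The exponents e_1 < ... < e_t of the nonzero terms of p, in this order. *)
Definition exponents (R : nzRingType) (p : {poly R}) : seq nat :=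
  [seq e <- iota 0 (size p) | p`_e != 0].

(* Indices are shifted by one: entry i of the list is e_(i+1).  The truncated
   subtraction is exact because the list is increasing, and the empty maximum
   is 0, which is the value for a monomial. *)
Definition max_gap (R : nzRingType) (p : {poly R}) : nat :=
  let e := exponents p in
  \max_(0 <= i < (size e).-1) (nth 0 e i.+1 - nth 0 e i)%N.

(* Main.v *)
(** Write p < q < r for the primes.  Inclusion-exclusion on the roots of unity
    gives Psi_n = Phi_pq * (1 + X^r + ... + X^((p-1)r)) * (X^(qr) - 1).
    The first two factors have total degree c = (p-1)(q-1) + (p-1)r, so if
    c < qr the product has consecutive exponents c and qr, and
    qr - c = 2qr - deg Psi_n.  Modulo X^q, Phi_pq (1 - X^p) agrees with 1 - X,
    so the exponents 1 and p of Psi_n are consecutive as well.  The upper bound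
    already holds for deg Psi_n in place of the gap. *)
Require Import Defs.
From HB Require Import structures.
From mathcomp Require Import all_boot all_order all_algebra all_field.
From mathcomp Require Import zify ring.

Set Implicit Arguments.
Unset Strict Implicit.
Unset Printing Implicit Defensive.

Import Order.TTheory GRing.Theory Num.Theory.
Local Open Scope ring_scope.

(** * Gaps read off from the coefficients of a polynomial *)

Section MaxGap.

Variables (R : nzRingType) (f : {poly R}).

Lemma mem_exponents e : (e \in exponents f) = (f`_e != 0).
Proof.
rewrite mem_filter mem_iota /= add0n; case: eqP => //= /eqP.
by apply: contraNT; rewrite -leqNgt => /leq_sizeP ->.
Qed.

Lemma sorted_exponents : sorted ltn (exponents f).
Proof. by apply: sorted_filter (iota_ltn_sorted _ _); apply: ltn_trans. Qed.

Lemma sorted_leq_exponents : sorted leq (exponents f).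
Proof. by have := sorted_exponents; rewrite ltn_sorted_uniq_leq => /andP[]. Qed.

(** The entry following [a] in the exponent list exceeds [a] and has a nonzero coefficient, so it
    cannot lie below [b]. *)
Lemma leq_max_gap a b : (a < b)%N -> f`_a != 0 -> f`_b != 0 ->
  (forall k, (a < k < b)%N -> f`_k = 0) -> (b - a <= max_gap f)%N.
Proof.
move=> ab fa fb fab; rewrite /max_gap; set e := exponents f.
have ae : a \in e by rewrite mem_exponents.
have be : b \in e by rewrite mem_exponents.
have ltab : (index a e < index b e)%N.
  rewrite ltnNge; apply: contraL ab => le_ba; rewrite -leqNgt.
  by apply: (sorted_leq_index leq_trans leqnn sorted_leq_exponents).
have lt_size : ((index a e).+1 < size e)%N.
  by rewrite (leq_ltn_trans ltab) // index_mem.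
have next_in : f`_(nth 0 e (index a e).+1)%N != 0.
  by rewrite -mem_exponents mem_nth.
have lt_next : (a < nth 0 e (index a e).+1)%N.
  rewrite -{1}(nth_index 0%N ae).
  by rewrite (sorted_ltn_nth ltn_trans) ?sorted_exponents // inE index_mem.
apply: (bigmaxn_sup_seq (index a e)) => //.
  by rewrite mem_index_iota; lia.
rewrite (nth_index 0%N ae) leq_sub2r // leqNgt.
by apply: contraNN next_in => ltb; rewrite fab ?lt_next // ltb.
Qed.

Lemma max_gap_leq_deg : (max_gap f <= deg f)%N.
Proof.
apply/bigop.bigmax_leqP_seq => i; rewrite mem_index_iota => /andP[_ ilt] _.
have : nth 0%N (exponents f) i.+1 \in exponents f by rewrite mem_nth // -ltn_predRL.
rewrite mem_filter mem_iota add0n => /and3P[_ _ lt_size].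
by rewrite (leq_trans (leq_subr _ _)) // /deg -ltnS (ltn_predK lt_size).
Qed.

End MaxGap.

(** * Multiplication by X^d - 1 and products over multiples of d *)

Lemma coef_mul_XnsubC1 (R : nzRingType) (f : {poly R}) d k :
  (f * ('X^d - 1))`_k = (if (k < d)%N then 0 else f`_(k - d)) - f`_k.
Proof. by rewrite mulrBr mulr1 coefB coefMXn. Qed.

(** Below degrees [d] and [e] both factors act as -1. This extracts low coefficients from product
    identities without any division. *)
Lemma eq_coef_mul_XnsubC1 (R : nzRingType) (f g : {poly R}) d e k :
  f * ('X^d - 1) = g * ('X^e - 1) -> (k < d)%N -> (k < e)%N -> f`_k = g`_k.
Proof.
move=> eq_fg ltkd ltke; have := congr1 (coefp k) eq_fg.
by rewrite /= !coef_mul_XnsubC1 ltkd ltke !sub0r => /oppr_inj.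
Qed.

Lemma big_nat_dvdn (T : Type) (idx : T) (op : Monoid.law idx) d k F :
  (0 < d)%N -> \big[op/idx]_(0 <= i < d * k | (d %| i)%N) F i
    = \big[op/idx]_(0 <= i < k) F (d * i)%N.
Proof.
move=> d0; elim: k => [|k IHk]; first by rewrite muln0 !big_nil.
rewrite big_nat_recr //= -IHk (@big_cat_nat _ _ _ (d * k)) ?leq_mul //=.
(* The new block of [d] indices contains a single multiple of [d], its first element. *)
congr (op _ _); rewrite big_ltn_cond; last by rewrite ltn_mul2l d0 /=.
rewrite dvdn_mulr // big_nat_cond big1 ?Monoid.mulm1 // => i /andP[/andP[ki ik]].
by case/dvdnP=> j def_i; rewrite def_i (mulnC j) !ltn_mul2l d0 /= in ki ik; lia.
Qed.

(** * Inclusion-exclusion on roots of unity *)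

Section UnityRoots.

Variables (F : fieldType) (m : nat) (w : F).
Hypothesis prim_w : m.-primitive_root w.

(** These roots are the powers of [w ^+ d], a primitive root of order [m %/ d]. *)
Lemma prod_dvdn_XsubC d : (d %| m)%N ->
  \prod_(0 <= j < m | (d %| j)%N) ('X - (w ^+ j)%:P) = 'X^(m %/ d) - 1.
Proof.
move=> dm; have m0 := prim_order_gt0 prim_w.
rewrite -{1}(divnK dm) mulnC big_nat_dvdn ?(dvdn_gt0 m0 dm) //.
have prim_wd : (m %/ d).-primitive_root (w ^+ d).
  have dvd_md : (m %/ d %| m)%N by apply/dvdnP; exists d; rewrite mulnC divnK.
  by have := dvdn_prim_root prim_w dvd_md; rewrite divnA ?mulKn.
by under eq_bigr do rewrite exprM; rewrite factor_Xn_sub_1.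
Qed.

Lemma inv_cyclotomicE :
  inv_cyclotomic w m = \prod_(0 <= j < m | ~~ coprime j m) ('X - (w ^+ j)%:P).
Proof.
have m0 := prim_order_gt0 prim_w; rewrite /inv_cyclotomic /coprime.
have gcd_gt1 j : (1 < gcdn j m)%N = (gcdn j m != 1%N).
  have : (0 < gcdn j m)%N by rewrite gcdn_gt0 m0 orbT.
  by case: gcdn => [|[|]].
under eq_bigl do rewrite gcd_gt1.
(* The last index m on the left matches index 0 on the right: w^m = w^0, and both have gcd m with
   m. *)
rewrite big_mkcond [RHS]big_mkcond big_nat_recr //= [RHS]big_ltn //= mulrC.
rewrite gcdnn gcd0n (prim_expr_order prim_w) expr0; congr (_ * _).
Qed.

Section TwoPrimes.

Variables p q : nat.
Hypotheses (p_prime : prime p) (q_prime : prime q) (neq_pq : p != q).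
Hypothesis def_m : m = (p * q)%N.

Lemma cyclotomic_pq :
  cyclotomic w m * ('X^p - 1) * ('X^q - 1) = ('X - 1) * ('X^(p * q) - 1).
Proof.
have [p0 q0] := (prime_gt0 p_prime, prime_gt0 q_prime).
have cop_pq : coprime p q by rewrite prime_coprime // dvdn_prime2.
have dvd_p : (p %| m)%N by rewrite def_m dvdn_mulr.
have dvd_q : (q %| m)%N by rewrite def_m dvdn_mull.
have m_p : (m %/ p)%N = q by rewrite def_m mulKn.
have m_q : (m %/ q)%N = p by rewrite def_m mulnK.
have m_m : (m %/ m)%N = 1%N by rewrite divnn (prim_order_gt0 prim_w).
have /esym Dp := prod_dvdn_XsubC dvd_q; have /esym Dq := prod_dvdn_XsubC dvd_p.
have /esym D1 := prod_dvdn_XsubC (dvdnn m).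
rewrite m_p m_q m_m expr1 in Dp Dq D1.
rewrite -def_m -(factor_Xn_sub_1 prim_w) Dp Dq D1 /cyclotomic.
rewrite -(big_mkord (fun k => coprime k m) (fun k => 'X - (w ^+ k)%:P)).
rewrite !(big_mkcond (fun j => _ %| j)%N) (big_mkcond (fun j => coprime j m)) /=.
(* It remains to count how often X - w^j occurs on each side, which depends only on which of p and q
   divide j. *)
rewrite -!big_split; apply: eq_bigr => j _ /=.
rewrite def_m Gauss_dvd // coprimeMr ![coprime j _]coprime_sym !prime_coprime //.
by case: (p %| j)%N; case: (q %| j)%N; rewrite /= ?(mulr1, mul1r).
Qed.

End TwoPrimes.

Section ThreePrimes.

Variables p q r : nat.
Hypotheses (p_prime : prime p) (q_prime : prime q) (r_prime : prime r).
Hypotheses (neq_pq : p != q) (neq_pr : p != r) (neq_qr : q != r).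
Hypothesis def_m : m = (p * q * r)%N.

Lemma inv_cyclotomic_pqr :
  inv_cyclotomic w m * ('X^p - 1) * ('X^q - 1) * ('X^r - 1)
    = ('X - 1) * ('X^(p * q) - 1) * ('X^(p * r) - 1) * ('X^(q * r) - 1).
Proof.
have [p0 [q0 r0]] := (prime_gt0 p_prime, (prime_gt0 q_prime, prime_gt0 r_prime)).
have cop_pq : coprime p q by rewrite prime_coprime // dvdn_prime2.
have cop_pr : coprime p r by rewrite prime_coprime // dvdn_prime2.
have cop_qr : coprime q r by rewrite prime_coprime // dvdn_prime2.
have D d e : (0 < d)%N -> m = (d * e)%N ->
    'X^e - 1 = \prod_(0 <= j < m | (d %| j)%N) ('X - (w ^+ j)%:P).
  by move=> d0 m_de; rewrite prod_dvdn_XsubC m_de ?mulKn ?dvdn_mulr.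
have D1 := D m 1%N (prim_order_gt0 prim_w) (esym (muln1 m)); rewrite expr1 in D1.
rewrite inv_cyclotomicE D1.
rewrite (D (q * r)%N p) ?(D (p * r)%N q) ?(D (p * q)%N r) ?muln_gt0 ?p0 ?q0 //; try lia.
rewrite (D r (p * q)%N) ?(D q (p * r)%N) ?(D p (q * r)%N) //; try lia.
rewrite !(big_mkcond (fun j => _ %| j)%N) (big_mkcond (fun j => ~~ coprime j m)) /=.
(* Again a count of X - w^j, now over the eight divisibility patterns of j by p, q and r. *)
rewrite -!big_split; apply: eq_bigr => j _ /=.
rewrite def_m !Gauss_dvd // ?coprimeMl ?cop_pr // !coprimeMr.
rewrite ![coprime j _]coprime_sym !prime_coprime //.
by case: (p %| j)%N; case: (q %| j)%N; case: (r %| j)%N; rewrite /= ?(mulr1, mul1r).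
Qed.

End ThreePrimes.

End UnityRoots.

(** * Factorization, low coefficients and degree of Psi for n = pqr *)

Section Gaps.

Variables (F : fieldType) (p q r : nat) (z : F).
Hypotheses (p_prime : prime p) (q_prime : prime q) (r_prime : prime r).
Hypotheses (lt_pq : (p < q)%N) (lt_qr : (q < r)%N).
Hypothesis prim_z : (p * q * r).-primitive_root z.

Let w := z ^+ r.
Let A := cyclotomic w (p * q).
(** The cofactor of X^(qr) - 1 in [Psi]; the sum is (X^(pr) - 1) / (X^r - 1). *)
Let C := A * \sum_(i < p) 'X^r ^+ i.
Let Psi := inv_cyclotomic z (p * q * r).

Let p_gt1 : (1 < p)%N. Proof. exact: prime_gt1. Qed.

Let prim_w : (p * q).-primitive_root w.
Proof.
have := dvdn_prim_root prim_z (dvdn_mulr r (dvdnn (p * q))).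
by rewrite mulKn // muln_gt0 !prime_gt0.
Qed.

Let cyclotomicE : A * ('X^p - 1) * ('X^q - 1) = ('X - 1) * ('X^(p * q) - 1).
Proof. by apply: cyclotomic_pq => //; lia. Qed.

Let Xn_sub_1_neq0 d : (0 < d)%N -> 'X^d - 1 != 0 :> {poly F}.
Proof. by move=> d0; rewrite monic_neq0 ?monic_Xn_sub_1. Qed.

Let sum_XrE : C * ('X^r - 1) = A * ('X^(p * r) - 1).
Proof. by rewrite mulnC exprM (subrX1 'X^r) mulrA mulrAC. Qed.

Let PsiE : Psi = C * ('X^(q * r) - 1).
Proof.
have nz : ('X^p - 1) * ('X^q - 1) * ('X^r - 1) != 0 :> {poly F}.
  by rewrite !mulf_neq0 ?Xn_sub_1_neq0 ?prime_gt0.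
apply: (mulIf nz); rewrite !mulrA inv_cyclotomic_pqr //; try lia.
rewrite -cyclotomicE.
transitivity (A * ('X^(p * r) - 1) * ('X^p - 1) * ('X^q - 1) * ('X^(q * r) - 1)).
  by ring.
by rewrite -sum_XrE; ring.
Qed.

Let coefA k : (k < q)%N -> (A * ('X^p - 1))`_k = ('X - 1)`_k.
Proof. by move=> ltkq; apply: (eq_coef_mul_XnsubC1 cyclotomicE) => //; nia. Qed.

Let coefA_lt k : (k < p)%N -> A`_k = - ('X - 1)`_k.
Proof.
move=> ltkp; rewrite -coefA ?(ltn_trans ltkp) // coef_mul_XnsubC1 ltkp.
by rewrite sub0r opprK.
Qed.

Let coefA_0 : A`_0 = 1.
Proof. by rewrite coefA_lt ?prime_gt0 // coefB coefX coef1 sub0r opprK. Qed.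

(** The coefficient of X^p in A (X^p - 1) is A_0 - A_p, and it vanishes because 1 < p < q. *)
Let coefA_p : A`_p = 1.
Proof.
have := coefA lt_pq; rewrite coef_mul_XnsubC1 ltnn subnn coefA_0.
rewrite coefB coefX coef1 !gtn_eqF ?prime_gt0 // subrr => /eqP.
by rewrite subr_eq0 => /eqP.
Qed.

Let coefC k : (k < r)%N -> C`_k = A`_k.
Proof. by move=> ltkr; apply: (eq_coef_mul_XnsubC1 sum_XrE) => //; nia. Qed.

Let coefPsi k : (k < q * r)%N -> Psi`_k = - C`_k.
Proof. by move=> ltk; rewrite PsiE coef_mul_XnsubC1 ltk sub0r. Qed.

Let size_mul_XnsubC1 (f : {poly F}) d :
  (0 < d)%N -> f != 0 -> size (f * ('X^d - 1)) = (size f + d)%N.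
Proof.
by move=> d0 nzf; rewrite size_Mmonic ?monic_Xn_sub_1 // size_Xn_sub_1 // addnS.
Qed.

Let A_neq0 : A != 0. Proof. by rewrite monic_neq0 ?cyclotomic_monic. Qed.

Let C_neq0 : C != 0.
Proof.
apply/eqP => C0; have /eqP := coefA_0.
by rewrite -coefC ?prime_gt0 // C0 coef0 eq_sym oner_eq0.
Qed.

Let size_A : (size A + p + q = p * q + 2)%N.
Proof.
have pq0 : (0 < p * q)%N by rewrite muln_gt0 !prime_gt0.
have X1_neq0 := Xn_sub_1_neq0 (ltn0Sn 0).
have := congr1 (fun f : {poly F} => size f) cyclotomicE.
rewrite /= (size_mul_XnsubC1 pq0 X1_neq0) (size_Xn_sub_1 _ (ltn0Sn 0)).
rewrite !size_mul_XnsubC1 ?mulf_neq0 ?Xn_sub_1_neq0 ?prime_gt0 //.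
by move=> ->; rewrite addnC.
Qed.

Let size_C : (size C + r = size A + p * r)%N.
Proof.
have := congr1 (fun f : {poly F} => size f) sum_XrE.
by rewrite /= !size_mul_XnsubC1 ?muln_gt0 ?prime_gt0.
Qed.

Let size_Psi : size Psi = (size C + q * r)%N.
Proof. by rewrite PsiE size_mul_XnsubC1 ?muln_gt0 ?prime_gt0. Qed.

Lemma deg_inv_cyclotomic :
  (deg Psi + (p + q + r) = p * q + p * r + q * r + 1)%N.
Proof.
(* Positivity makes the predecessor in [deg] exact; the three size identities then combine
   linearly. *)
have : (0 < size C)%N by rewrite size_poly_gt0.
rewrite /deg; lia.
Qed.

Lemma leq_pred_max_gap : (p.-1 <= max_gap Psi)%N.
Proof.
have lt_r k : (k <= p)%N -> (k < r)%N.
  by move=> le_kp; rewrite (leq_ltn_trans le_kp) ?(ltn_trans lt_pq).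
(* Since p < r < qr, [Psi] starts like -A, and A starts 1 - X + X^p with no terms strictly between
   degrees 1 and p. *)
have Psi_A k : (k <= p)%N -> Psi`_k = - A`_k.
  by move=> le_kp; rewrite coefPsi ?coefC ?lt_r //; have := lt_r k le_kp; nia.
rewrite -subn1; apply: leq_max_gap => //.
- rewrite Psi_A 1?ltnW // coefA_lt // coefB coefX coef1 subr0 opprK.
  exact: oner_neq0.
- by rewrite Psi_A // coefA_p oppr_eq0 oner_neq0.
move=> k /andP[lt1k ltkp].
rewrite Psi_A 1?ltnW // coefA_lt // coefB coefX coef1.
by case: k lt1k {ltkp} => [|[|k]] // _; rewrite subr0 !oppr0.
Qed.

Lemma leq_center_max_gap : (2 * (q * r) <= deg Psi + max_gap Psi)%N.
Proof.
have C_gt0 : (0 < size C)%N by rewrite size_poly_gt0.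
(* As deg Psi = deg C + qr, the bound is trivial once deg C reaches qr; otherwise it asks for a gap
   of qr - deg C. *)
have [le_qr|lt_Cqr] := leqP (q * r) (size C).-1; first by rewrite /deg; lia.
suff : (q * r - (size C).-1 <= max_gap Psi)%N by rewrite /deg; lia.
apply: leq_max_gap => //.
- by rewrite coefPsi // oppr_eq0 -/(lead_coef C) lead_coef_eq0.
(* The coefficient at qr is C_0 - C_(qr), where C_0 = 1 and C_(qr) = 0 because qr exceeds deg C. *)
- rewrite PsiE coef_mul_XnsubC1 ltnn subnn.
  rewrite [C`_(q * r)]nth_default ?subr0; last exact: leq_trans (leqSpred _) lt_Cqr.
  by rewrite coefC ?prime_gt0 // coefA_0 oner_neq0.
move=> k /andP[ltCk ltk]; rewrite coefPsi // nth_default ?oppr0 //.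
exact: leq_trans (leqSpred _) ltCk.
Qed.

End Gaps.

Theorem theorem3 (n p1 p2 p3 : nat) (z : algC)
  (hn : n = (p1 * p2 * p3)%N)
  (h12 : (p1 < p2)%N) (h23 : (p2 < p3)%N)
  (hp1 : prime p1) (hp2 : prime p2) (hp3 : prime p3)
  (ho1 : odd p1) (ho2 : odd p2) (ho3 : odd p3)
  (hz : n.-primitive_root z) :
  let Psi := inv_cyclotomic z n in
  Num.max (p1%:R - 1 : rat) (2 * n%:R * (1 / p1%:R) - (deg Psi)%:R)
    <= (max_gap Psi)%:R /\
  (max_gap Psi)%:R
    < 2 * n%:R * (1 / p1%:R + 1 / p2%:R + 1 / p3%:R) - (deg Psi)%:R :> rat.
Proof.
subst n; move=> Psi.
have [p1_gt0 [p2_gt0 p3_gt0]] :=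
  (prime_gt0 hp1, (prime_gt0 hp2, prime_gt0 hp3)).
have nz1 : p1%:R != 0 :> rat by rewrite pnatr_eq0; lia.
have nz2 : p2%:R != 0 :> rat by rewrite pnatr_eq0; lia.
have nz3 : p3%:R != 0 :> rat by rewrite pnatr_eq0; lia.
split.
  rewrite ge_max; apply/andP; split.
    rewrite lerBlDr natr1 ler_nat -(prednK p1_gt0) ltnS.
    exact: (leq_pred_max_gap hp1 hp2 hp3 h12 h23 hz).
  have -> : 2 * (p1 * p2 * p3)%:R * (1 / p1%:R) = (2 * (p2 * p3))%:R :> rat.
    by rewrite !natrM; field.
  rewrite lerBlDr -natrD ler_nat addnC.
  exact: (leq_center_max_gap hp1 hp2 hp3 h12 h23 hz).
have -> : 2 * (p1 * p2 * p3)%:R * (1 / p1%:R + 1 / p2%:R + 1 / p3%:R)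
    = (2 * (p1 * p2 + p1 * p3 + p2 * p3))%:R :> rat.
  by rewrite !(natrM, natrD); field; rewrite nz1 nz2 nz3.
rewrite ltrBrDr -natrD ltr_nat.
have degPsi : (deg Psi + (p1 + p2 + p3) = p1 * p2 + p1 * p3 + p2 * p3 + 1)%N.
  exact: (deg_inv_cyclotomic hp1 hp2 hp3 h12 h23 hz).
have gapPsi : (max_gap Psi <= deg Psi)%N := max_gap_leq_deg Psi.
(* Degree plus gap is at most twice the degree, which misses the right-hand side by 2(p1 + p2 + p3 -
   1) > 0. *)
by move: (deg Psi) (max_gap Psi) degPsi gapPsi => d g; lia.
Qed.
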